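(* Let $G$ be a connected graph on vertex set $[n]$ with Laplacian matrix $L$, let $L_B=LA$, and let $\kappa$ be the number of spanning trees of $G$. Then the Laplacian simplex $T_G$ is reflexive if and only if for each $i\in[n]$ and each $1\le j\le n-1$, $\kappa$ divides $\sum_{k=1}^{n-1}C_{kj}=\sum_{k=1}^{n-1}(-1)^{k+j}M_{kj}$, where $C_{kj}$ and $M_{kj}$ are the $(k,j)$ cofactor and minor of the $(n-1)\times(n-1)$ matrix $L_B(i\mid\emptyset)$ (with its rows reindexed by $[n-1]$ in increasing order).
   Context: The Laplacian $L$ of a graph on $[n]$ has $L_{ii}=\deg(i)$, $L_{ij}=-1$ if $\{i,j\}$ is an edge and $0$ otherwise. Let $A$ be the $n\times(n-1)$ matrix with $a_{ij}=1$ if $i\le j\le n-1$ and $0$ otherwise; $L_B=LA$. The Laplacian simplex $T_G\subseteq\mathbb{R}^{n-1}$ is the convex hull of the rows of $L_B$. $M(S\mid T)$ denotes the submatrix of $M$ obtained by deleting rows indexed by $S$ and columns indexed by $T$. A full-dimensional lattice polytope $P$ is reflexive if it contains the origin in its interior and its dual $\{x:x\cdot y\le1\ \forall y\in P\}$ is a lattice polytope. *)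

(* Defs.v *)
From mathcomp Require Export all_boot all_order all_algebra.
From mathcomp Require Export boolp classical_sets reals topology.
From mathcomp Require Export normedtype.
Export Order.TTheory GRing.Theory Num.Theory.
Export numFieldNormedType.Exports.

Set Implicit Arguments.
Unset Strict Implicit.
Unset Printing Implicit Defensive.

Local Open Scope ring_scope.

(* A simple graph on V is a symmetric irreflexive relation e : rel V. *)

Definition connected_graph (V : finType) (e : rel V) : Prop :=
  forall x y : V, connect e x y.

(* A cycle is the list of its at least three distinct vertices. *)
Definition acyclic_graph (V : finType) (e : rel V) : Prop :=
  forall c : seq V, (2 < size c)%N -> ~ ucycle e c.

Definition edges (V : finType) (e : rel V) : {set {set V}} :=
  [set [set p.1; p.2] | p in [pred p : V * V | e p.1 p.2]].

Definition edge_rel (V : finType) (F : {set {set V}}) : rel V :=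
  [rel x y | [set x; y] \in F].

(* Spanning trees are identified with their edge sets. *)
Definition spanning_tree (V : finType) (e : rel V) (F : {set {set V}}) : Prop :=
  [/\ F \subset edges e, connected_graph (edge_rel F)
    & acyclic_graph (edge_rel F)].

Definition num_spanning_trees (V : finType) (e : rel V) : nat :=
  #|[set F : {set {set V}} | `[< spanning_tree e F >] ]|.

Definition laplacian (m : nat) (e : rel 'I_m) : 'M[int]_m :=
  \matrix_(i, j) if i == j then #|[set k | e i k]|%:R else - (e i j)%:R.

(* The number of vertices is n.+1; indices start at 0, so the index shift
   cancels in the condition i <= j. *)
Definition Amx (n : nat) : 'M[int]_(n.+1, n) :=
  \matrix_(i, j) (i <= j)%N%:R.

Definition LB (n : nat) (e : rel 'I_n.+1) : 'M[int]_(n.+1, n) :=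
  laplacian e *m Amx n.

Definition LB_del (n : nat) (e : rel 'I_n.+1) (i : 'I_n.+1) : 'M[int]_n :=
  row' i (LB e).

Definition minor (n : nat) (M : 'M[int]_n) (k j : 'I_n) : int :=
  \det (row' k (col' j M)).

Local Open Scope classical_set_scope.

Definition convex_hull (R : realType) (n : nat) (S : set 'rV[R]_n) :
    set 'rV[R]_n :=
  [set y | exists (m : nat) (p : 'I_m -> 'rV[R]_n) (c : 'I_m -> R),
    [/\ forall i, S (p i), forall i, 0 <= c i, \sum_i c i = 1
      & y = \sum_i c i *: p i]].

Definition affine_hull (R : realType) (n : nat) (S : set 'rV[R]_n) :
    set 'rV[R]_n :=
  [set y | exists (m : nat) (p : 'I_m -> 'rV[R]_n) (c : 'I_m -> R),
    [/\ forall i, S (p i), \sum_i c i = 1 & y = \sum_i c i *: p i]].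

Definition full_dimensional (R : realType) (n : nat) (P : set 'rV[R]_n) : Prop :=
  affine_hull P = setT.

Definition lattice_polytope (R : realType) (n : nat) (P : set 'rV[R]_n) : Prop :=
  exists s : seq 'rV[int]_n,
    P = convex_hull [set map_mx (intr : int -> R) v | v in [set` s]].

Definition dual_polytope (R : realType) (n : nat) (P : set 'rV[R]_n) :
    set 'rV[R]_n :=
  [set x | forall y, P y -> \sum_i x 0 i * y 0 i <= 1].

Definition reflexive_polytope (R : realType) (n : nat) (P : set 'rV[R]_n) :
    Prop :=
  [/\ lattice_polytope P, full_dimensional P, interior P 0
    & lattice_polytope (dual_polytope P)].

Definition laplacian_simplex (R : realType) (n : nat) (e : rel 'I_n.+1) :
    set 'rV[R]_n :=
  convex_hull [set row i (map_mx (intr : int -> R) (LB e)) | i in setT].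

Arguments laplacian_simplex R {n} e.

(* Main.v *)
Require Import Defs.
From mathcomp Require Import perm zify ring lra.

Set Implicit Arguments.
Unset Strict Implicit.
Unset Printing Implicit Defensive.

Local Open Scope ring_scope.

(** The rows [v_0, ..., v_n] of [L_B] sum to zero, and deleting the [i]-th one
    leaves a square matrix of determinant [+/- kappa <> 0].  Hence [T_G] is a
    simplex with the origin in its interior, and its dual is the simplex whose
    vertices [x_i] are given by [<v_k, x_i> = 1] for [k <> i].  The dual is a lattice
    polytope iff all [x_i] are integral, and Cramer's rule writes their
    coordinates as column sums of cofactors divided by [+/- kappa].

    The determinant is computed by the matrix-tree theorem.  Replace the [r]-th
    row of the Laplacian by the [r]-th unit vector; every other row [u] is the
    sum over the neighbours [w] of [u] of [delta_u - delta_w].  By multilinearity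
    the determinant is a sum over choices [f] of one neighbour per vertex, and
    the term of [f] is 1 if iterating [f] leads every vertex to [r] and 0
    otherwise.  Such [f] are the spanning trees oriented towards [r]. *)

(** * Parent maps towards a root, and spanning trees *)

Section Arborescences.

Variables (V : finType) (r : V).

(** A tree oriented towards [r] is encoded by its parent map; making [r] a fixed point keeps the map
    total and lets [fconnect] express reaching the root. *)
Definition arborescence (e : rel V) (f : {ffun V -> V}) : bool :=
  [&& f r == r, [forall u, (u != r) ==> e u (f u)] & [forall u, fconnect f u r]].

(** The depth is the least number of iterations leading to [r]; it serves as induction measure along
    [f]. *)
Lemma arborescence_depth (e : rel V) (f : {ffun V -> V}) : arborescence e f ->
  {d : V -> nat | forall u, u != r -> d u = (d (f u)).+1}.
Proof.
case/and3P=> /eqP fr _ /forallP fc.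
have ex u : exists k, iter k f u == r.
  by exists (findex f u r); rewrite iter_findex.
exists (fun u => ex_minn (ex u)) => u ur.
case: ex_minnP => -[|k] /eqP ku kmin; first by rewrite /= in ku; rewrite ku eqxx in ur.
case: ex_minnP => l /eqP lu lmin; congr _.+1; apply/eqP.
rewrite eqn_leq lmin ?andbT; last by rewrite -iterSr ku.
by rewrite -ltnS kmin // iterSr lu.
Qed.

Lemma connected_arborescence (e : rel V) :
  connected_graph e -> exists f, arborescence e f.
Proof.
move=> ec.
pose P u k := [exists p : k.-tuple V, path e u p && (last u p == r)].
have ex u : exists k, P u k.
  have /connectP[p ep lp] := ec u r.
  by exists (size p); apply/existsP; exists (in_tuple p); rewrite ep -lp /=.
pose d u := ex_minn (ex u).
(* Since [d] is the distance to [r], each vertex points to a strictly closer neighbour; [fP] shows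
   that the default of [odflt] never arises. *)
pose f := [ffun u => if u == r then r else
                     odflt r [pick v | e u v && (d v < d u)%N]].
have fP u : u != r -> e u (f u) && (d (f u) < d u)%N.
  move=> ur; rewrite ffunE (negPf ur); case: pickP => //= none.
  suff [v uv] : exists v, e u v && (d v < d u)%N by rewrite none in uv.
  (* The first step of a shortest path from [u] to [r] reaches such a neighbour. *)
  rewrite {2}/d; case: ex_minnP => k /existsP[[[|v p] sp] /andP[/= ep lp]] _.
    by rewrite lp in ur.
  case/andP: ep => uv ep; exists v; rewrite uv /= /d.
  case: ex_minnP => m _ mmin; rewrite -(eqP sp) ltnS mmin //.
  by apply/existsP; exists (in_tuple p); rewrite /= ep.
exists f; apply/and3P; split; first by rewrite ffunE eqxx.
  by apply/forall_inP => u /fP /andP[].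
apply/forallP => u; have [m] := ubnP (d u); elim: m u => // m IH u du.
have [->|ur] := eqVneq u r; first exact: connect0.
apply: connect_trans (fconnect1 f u) (IH _ _).
by have /andP[_] := fP _ ur; lia.
Qed.

Definition arc_edges (f : {ffun V -> V}) : {set {set V}} :=
  [set [set u; f u] | u in [pred u | u != r]].

Lemma set2_eq (a b c d : V) : [set a; b] = [set c; d] ->
  (a = c /\ b = d) \/ (a = d /\ b = c).
Proof.
move=> E.
have := set21 a b; have := set22 a b; rewrite E !inE.
have := set21 c d; have := set22 c d; rewrite -E !inE.
do 4!case/orP => /eqP ?; subst; auto.
Qed.

Lemma edge_rel_sym (F : {set {set V}}) : symmetric (edge_rel F).
Proof. by move=> x y; rewrite /edge_rel /= finset.setUC. Qed.

Lemma arc_edgesP (f : {ffun V -> V}) x y : edge_rel (arc_edges f) x y ->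
  (x != r /\ f x = y) \/ (y != r /\ f y = x).
Proof.
case/imsetP => u /= ur /set2_eq[[-> ->]|[-> ->]]; auto.
Qed.

Lemma arc_edges_arc (f : {ffun V -> V}) u :
  u != r -> edge_rel (arc_edges f) u (f u).
Proof. by move=> ur; apply/imsetP; exists u. Qed.

Lemma arc_edges_connected (e : rel V) f :
  arborescence e f -> connected_graph (edge_rel (arc_edges f)).
Proof.
move=> af.
have cr u : connect (edge_rel (arc_edges f)) u r.
  have [d dS] := arborescence_depth af.
  have [m] := ubnP (d u); elim: m u => // m IH u du.
  have [->|ur] := eqVneq u r; first exact: connect0.
  apply: connect_trans (connect1 (arc_edges_arc f ur)) (IH _ _).
  by rewrite -ltnS -dS.
move=> x y; apply: connect_trans (cr x) _.
by rewrite (sym_connect_sym (edge_rel_sym _)).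
Qed.

(* In a cycle, a vertex of maximal depth would have its two distinct neighbours
   both equal to its parent. *)
Lemma arc_edges_acyclic (e : rel V) f :
  arborescence e f -> acyclic_graph (edge_rel (arc_edges f)).
Proof.
move=> af c sc /andP[cc uc].
have [d dS] := arborescence_depth af.
have [x0 x0c] : exists x, x \in c.
  by case: c sc {cc uc} => // x c; exists x; rewrite mem_head.
case: (arg_maxnP d x0c) => u /= uc' umax.
have parent v : v \in c -> edge_rel (arc_edges f) u v -> v = f u.
  move=> vc /arc_edgesP[[_ ->]//|[vr fv]].
  by have := umax _ vc; rewrite (dS v vr) fv; lia.
case: (rot_to uc') => i p defc.
have : cycle (edge_rel (arc_edges f)) (u :: p) by rewrite -defc rot_cycle.
have : uniq (u :: p) by rewrite -defc rot_uniq.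
have sub v : v \in p -> v \in c by rewrite -(mem_rot i c) defc inE orbC => ->.
move: sc; rewrite -(size_rot i) defc.
case: p sub {defc} => [|a p] //; case/lastP: p => // p b sub _ /and3P[_ + _] /=.
rewrite rcons_path last_rcons => ab /and3P[ua _ bu].
have af' : a = f u by apply: parent ua; apply: sub; rewrite mem_head.
have bf : b = f u.
  apply: parent; first by apply: sub; rewrite inE mem_rcons mem_head orbT.
  by rewrite edge_rel_sym.
by move: ab; rewrite af' bf mem_rcons mem_head.
Qed.

(** Induction on the depth for [f]: if [g] used the edge of [u] and [f u] backwards, then
    [g (f u) = u], so [f (f u) = u] by induction, against the decrease of depth. *)
Lemma arc_edges_inj (e : rel V) :
  {in arborescence e &, injective arc_edges}.
Proof.
move=> f g af ag E; have [d dS] := arborescence_depth af.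
apply/ffunP => u; have [m] := ubnP (d u); elim: m u => // m IH u du.
have [ur|ur] := eqVneq u r.
  by case/and3P: af => /eqP fr _ _; case/and3P: ag => /eqP gr _ _; rewrite ur fr gr.
have := arc_edges_arc f ur; rewrite E => /arc_edgesP[[_ ->]//|[fur gfu]].
have := dS u ur; have := dS (f u) fur; rewrite (IH (f u)); last by rewrite -ltnS -dS.
by rewrite gfu; lia.
Qed.

Lemma arborescence_spanning_tree (e : rel V) f :
  arborescence e f -> spanning_tree e (arc_edges f).
Proof.
move=> af; split; last 2 first.
- exact: arc_edges_connected af.
- exact: arc_edges_acyclic af.
case/and3P: af => _ /forall_inP ef _.
by apply/fintype.subsetP => _ /imsetP[u ur ->]; apply/imsetP; exists (u, f u) => //=;
  exact: ef.
Qed.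

Lemma edges_rel (e : rel V) (F : {set {set V}}) :
  symmetric e -> F \subset edges e -> subrel (edge_rel F) e.
Proof.
move=> esym /fintype.subsetP Fe x y /Fe /imsetP[[a b] /= ab].
by case/set2_eq => [[-> ->]|[-> ->]] //; rewrite esym.
Qed.

(* An edge outside [arc_edges f] would close a cycle with the path joining its
   ends along [f]. *)
Lemma spanning_tree_arborescence (e : rel V) F :
  symmetric e -> irreflexive e -> spanning_tree e F ->
  exists2 f, arborescence e f & F = arc_edges f.
Proof.
move=> esym eirr [Fe Fconn Facy].
have Fsub := edges_rel esym Fe.
have [f af] := connected_arborescence Fconn.
have [fr /forall_inP Ff fc] := and3P af.
exists f.
  apply/and3P; split=> //; apply/forall_inP => u ur; exact/Fsub/Ff.
have fF : arc_edges f \subset F.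
  by apply/fintype.subsetP => _ /imsetP[u ur ->]; exact: Ff.
apply/eqP; rewrite finset.eqEsubset fF andbT; apply/fintype.subsetP => E EF.
have /imsetP[[x y] /= xy defE] := fintype.subsetP Fe _ EF.
apply: contraT => Ef.
have /connectP[p0 fp0 ly0] := arc_edges_connected af x y.
case/shortenP: fp0 ly0 => p fp up _ ly.
(* Length 0 would make the edge a loop, length 1 would put it in [arc_edges f], and a longer path
   closes to a cycle on at least three vertices. *)
case: p fp up ly => [|a [|b p]] /= fp up ly.
- by have : e x y := xy; rewrite ly eirr.
- by case/andP: fp; rewrite /edge_rel /= -ly -defE (negPf Ef).
have sF : subrel (edge_rel (arc_edges f)) (edge_rel F).
  by move=> u v; exact: (fintype.subsetP fF).
case: (Facy (x :: a :: b :: p)) => //; apply/andP; split=> //=.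
case/and3P: fp => xa ab bp.
rewrite !sF //= rcons_path (sub_path sF bp) -ly /edge_rel /= finset.setUC -defE //.
Qed.

Lemma num_spanning_treesE (e : rel V) : symmetric e -> irreflexive e ->
  num_spanning_trees e = #|[set f | arborescence e f]|.
Proof.
move=> esym eirr.
rewrite -(card_in_imset (f := arc_edges)); last first.
  move=> f g; rewrite !inE; exact: arc_edges_inj.
apply: eq_card => F; rewrite !inE; apply/asboolP/imsetP.
  case/(spanning_tree_arborescence esym eirr) => f af ->.
  by exists f; rewrite ?inE.
by case=> f; rewrite inE => af ->; exact: arborescence_spanning_tree af.
Qed.

Lemma num_spanning_trees_gt0 (e : rel V) : symmetric e -> irreflexive e ->
  connected_graph e -> (0 < num_spanning_trees e)%N.
Proof.
move=> esym eirr /connected_arborescence[f af].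
by rewrite num_spanning_treesE //; apply/card_gt0P; exists f; rewrite inE.
Qed.

End Arborescences.

(** * The matrix-tree theorem *)

Section MatrixTree.

Variables (m : nat) (r : 'I_m).

Definition fun_laplacian (f : {ffun 'I_m -> 'I_m}) : 'M[int]_m :=
  \matrix_(u, v) ((u == v)%:R - ((u != r) && (f u == v))%:R).

(** The indicator vector of the vertices that never reach [r] lies in the kernel, because [u] and
    [f u] reach [r] together; it is nonzero at [w]. *)
Lemma det_fun_laplacian_eq0 (f : {ffun 'I_m -> 'I_m}) (w : 'I_m) :
  f r = r -> ~~ fconnect f w r -> \det (fun_laplacian f) = 0.
Proof.
move=> fr nw.
pose c : 'cV[int]_m := \col_u (~~ fconnect f u r)%:R.
have Mc : fun_laplacian f *m c = 0.
  apply/matrixP => u j; rewrite !mxE.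
  under eq_bigr do rewrite !mxE mulrBl.
  rewrite sumrB (bigD1 u) //= eqxx mul1r [X in _ + X - _]big1 ?addr0; last first.
    by move=> v vu; rewrite eq_sym (negPf vu) mul0r.
  have [->|ur] := eqVneq u r.
    by rewrite connect0 /= big1 ?subrr // => i _; rewrite mul0r.
  rewrite (bigD1 (f u)) //= eqxx mul1r [X in _ - (_ + X)]big1 ?addr0; last first.
    by move=> v vu; rewrite eq_sym (negPf vu) mul0r.
  suff -> : fconnect f u r = fconnect f (f u) r by rewrite subrr.
  apply/idP/idP => [/iter_findex|]; last exact/connect_trans/fconnect1.
  case: findex => [/= E|k]; first by rewrite E eqxx in ur.
  by rewrite iterSr => <-; exact: fconnect_iter.
have /matrixP/(_ w 0) := congr1 (mulmx (\adj (fun_laplacian f))) Mc.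
by rewrite mulmxA mul_adj_mx mulmx0 mul_scalar_mx !mxE nw mulr1.
Qed.

(* A permutation [s] contributing to the Leibniz formula moves each of its
   non-fixed points along [f], and so can never carry it to the fixed point [r]. *)
Lemma det_fun_laplacian (f : {ffun 'I_m -> 'I_m}) :
  f r = r -> (forall u, fconnect f u r) -> \det (fun_laplacian f) = 1.
Proof.
move=> fr fc.
have fix_r u : f u = u -> u = r.
  move=> fu; have /iter_findex := fc u; elim: findex => //= k IH.
  by rewrite -iterS iterSr fu.
rewrite /determinant (bigD1 (1%g : 'S_m)) //= odd_perm1 expr0 mul1r.
rewrite [X in X + _]big1 ?[X in _ + X]big1 ?addr0 //.
  move=> s s1.
  have [u su] : exists u, s u != u.
    apply/existsP; apply: contraT; rewrite negb_exists => /forallP sE.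
    case/eqP: s1; apply/permP => u; rewrite perm1.
    by have := sE u; rewrite negbK => /eqP.
  have [/existsP[v]|] := boolP [exists v, fun_laplacian f v (s v) == 0].
    by move=> /eqP v0; rewrite (bigD1 v) //= v0 mul0r mulr0.
  rewrite negb_exists => /forallP nz.
  have sf v : s v != v -> v != r /\ f v = s v.
    move=> sv; have := nz v; rewrite !mxE (eq_sym v (s v)) (negPf sv) sub0r oppr_eq0.
    by case: andP => [[-> /eqP->]|].
  have si k : iter k f u = iter k s u /\ s (iter k s u) != iter k s u.
    elim: k => [|k [IH1 IH2]] //=; split; last by rewrite (inj_eq perm_inj).
    by rewrite IH1; case: (sf _ IH2).
  have [E1 E2] := si (findex f u r); rewrite iter_findex // in E1.
  by have [] := sf _ E2; rewrite -E1 eqxx.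
move=> u _; rewrite perm1 mxE eqxx.
by have [->|ur] := eqVneq u r; rewrite ?subr0 //=; case: eqP => [/fix_r E|_];
  rewrite ?E ?eqxx ?subr0 // in ur *.
Qed.

Definition rooted_laplacian (e : rel 'I_m) : 'M[int]_m :=
  \matrix_(u, v) if u == r then (v == r)%:R else laplacian e u v.

Lemma laplacian_sum (e : rel 'I_m) u v : irreflexive e ->
  laplacian e u v = \sum_w (e u w)%:R * ((u == v)%:R - (w == v)%:R).
Proof.
move=> eirr; rewrite mxE.
under eq_bigr do rewrite mulrBr.
rewrite sumrB -mulr_suml [X in _ - X](bigD1 v) //= eqxx mulr1 [X in _ - (_ + X)]big1 ?addr0.
  have -> : (\sum_i (e u i)%:R : int) = #|[set k | e u k]|%:R.
    rewrite -sum1_card natr_sum [RHS]big_mkcond.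
    by apply: eq_bigr => k _; rewrite inE; case: (e u k).
  case: eqP => [<-|_]; first by rewrite eirr subr0 mulr1.
  by rewrite mulr0 sub0r.
by move=> w wv; rewrite (negPf wv) mulr0.
Qed.

(* Each row of [rooted_laplacian e] is a sum of rows of [fun_laplacian f] over
   the choices of [f u]; expand by multilinearity. *)
Theorem matrix_tree (e : rel 'I_m) : symmetric e -> irreflexive e ->
  \det (rooted_laplacian e) = (num_spanning_trees e)%:Z.
Proof.
move=> esym eirr.
(* The weights of row [r] are concentrated on [r], so that only choices with [f r = r] survive. *)
pose a u w : int := if u == r then (w == r)%:R else (e u w)%:R.
have rowE u v : rooted_laplacian e u v =
    \sum_w a u w * ((u == v)%:R - ((u != r) && (w == v))%:R).
  rewrite mxE /a; have [->|ur] := eqVneq u r; last exact: laplacian_sum.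
  rewrite (bigD1 r) //= eqxx mul1r big1 ?addr0 ?subr0 1?eq_sym //.
  by move=> w wr; rewrite (negPf wr) mul0r.
have -> : \det (rooted_laplacian e) =
    \sum_(f : {ffun 'I_m -> 'I_m}) (\prod_u a u (f u)) * \det (fun_laplacian f).
  rewrite /determinant.
  under [RHS]eq_bigr do rewrite mulr_sumr.
  rewrite exchange_big /=; apply: eq_bigr => s _.
  under eq_bigr do rewrite rowE.
  rewrite bigA_distr_bigA mulr_sumr; apply: eq_bigr => f _.
  rewrite big_split /= mulrCA; congr (_ * (_ * _)).
  by apply: eq_bigr => u _; rewrite mxE.
rewrite (num_spanning_treesE r esym eirr) -sum1_card -natz natr_sum.
rewrite [RHS]big_mkcond; apply: eq_bigr => f _; rewrite inE.
have [/and3P[/eqP fr /forall_inP fe /forallP fc]|naf] := boolP (arborescence r e f).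
  rewrite det_fun_laplacian // mulr1 big1 // => u _; rewrite /a.
  by have [->|ur] := eqVneq u r; rewrite ?fr ?eqxx ?fe.
have [fr|fr] := eqVneq (f r) r; last first.
  by rewrite (bigD1 r) //= /a eqxx (negPf fr) !mul0r.
move: naf; rewrite /arborescence fr eqxx /= negb_and !negb_forall.
case/orP => /existsP[u]; last by move=> /det_fun_laplacian_eq0->; rewrite ?mulr0.
by rewrite negb_imply => /andP[ur /negPf uf]; rewrite (bigD1 u) //= /a (negPf ur) uf !mul0r.
Qed.

End MatrixTree.

(** * Row and column sums, and the maximal minors of [LB e] *)

Definition upper_ones (m : nat) : 'M[int]_m := \matrix_(i, j) (i <= j)%N%:R.

Lemma det_upper_ones m : \det (upper_ones m) = 1.
Proof.
rewrite -det_tr det_trig; first by rewrite big1 // => i _; rewrite !mxE leqnn.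
by apply/is_trig_mxP => i j ij; rewrite !mxE leqNgt ij.
Qed.

Lemma laplacian_row_sum m (e : rel 'I_m) u : irreflexive e ->
  \sum_v laplacian e u v = 0.
Proof.
move=> eirr; under eq_bigr do rewrite laplacian_sum //.
rewrite exchange_big big1 //= => w _.
rewrite -mulr_sumr sumrB (bigD1 u) //= [X in _ + X - _]big1; last first.
  by move=> v vu; rewrite eq_sym (negPf vu).
rewrite [X in _ - X](bigD1 w) //= [X in _ - (_ + X)]big1; last first.
  by move=> v vw; rewrite eq_sym (negPf vw).
by rewrite !eqxx subrr mulr0.
Qed.

Lemma laplacian_sym m (e : rel 'I_m) : symmetric e ->
  (laplacian e)^T = laplacian e.
Proof.
move=> esym; apply/matrixP => u v; rewrite !mxE eq_sym esym.
by case: eqP => // ->.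
Qed.

Lemma LB_col_sum n (e : rel 'I_n.+1) j : symmetric e -> irreflexive e ->
  \sum_i LB e i j = 0.
Proof.
move=> esym eirr; under eq_bigr do rewrite mxE.
rewrite exchange_big big1 //= => k _; rewrite -mulr_suml.
under eq_bigr do rewrite -laplacian_sym // mxE.
by rewrite laplacian_row_sum // mul0r.
Qed.

(* Completing [Amx] by a column of ones makes it unitriangular, and since the
   rows of [L] sum to zero, the completed product expands along that column. *)
Lemma det_LB_del n (e : rel 'I_n.+1) (i : 'I_n.+1) :
  symmetric e -> irreflexive e ->
  (num_spanning_trees e)%:Z = (-1) ^+ (i + n) * \det (LB_del e i).
Proof.
move=> esym eirr.
rewrite -(matrix_tree i esym eirr).
have -> : \det (rooted_laplacian i e) = \det (rooted_laplacian i e *m upper_ones n.+1).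
  by rewrite det_mulmx det_upper_ones mulr1.
rewrite (expand_det_col _ ord_max) (bigD1 i) //= big1 ?addr0.
  rewrite /cofactor; set M := _ *m _.
  have -> : row' i (col' ord_max M) = LB_del e i.
    apply/matrixP => u v; rewrite !mxE; apply: eq_bigr => w _; rewrite !mxE.
    rewrite eq_sym (negPf (neq_lift _ _)) lift_max; congr (_ * _).
  suff -> : M i ord_max = 1 by rewrite mul1r.
  rewrite mxE (bigD1 i) //= !mxE !eqxx -ltnS ltn_ord mul1r big1 ?addr0 //.
  by move=> k ki; rewrite !mxE eqxx (negPf ki) mul0r.
move=> k ki; suff -> : (rooted_laplacian i e *m upper_ones n.+1) k ord_max = 0.
  by rewrite mul0r.
rewrite mxE -[RHS](laplacian_row_sum k eirr); apply: eq_bigr => v _.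
by rewrite !mxE (negPf ki) -ltnS ltn_ord mulr1.
Qed.

(** * Convex hulls, and simplices described by facet inequalities *)

Section Polytopes.

Local Open Scope classical_set_scope.

Variables (R : realType) (n : nat).
Implicit Types (y : 'rV[R]_n) (S : set 'rV[R]_n).

Lemma dot_mulmx (x y : 'rV[R]_n) : \sum_i x 0 i * y 0 i = (x *m y^T) 0 0.
Proof. by rewrite mxE; apply: eq_bigr => i _; rewrite mxE. Qed.

Lemma sub_convex_hull S : S `<=` convex_hull S.
Proof.
move=> y Sy; exists 1%N, (fun=> y), (fun=> 1); split=> //.
  by rewrite big_ord1.
by rewrite big_ord1 scale1r.
Qed.

Lemma dual_convex_hull S : dual_polytope (convex_hull S) =
  [set x | forall y, S y -> \sum_i x 0 i * y 0 i <= 1].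
Proof.
apply/seteqP; split=> x /= xS y; first by move/sub_convex_hull/xS.
case=> m [p [c [Sp c0 c1 ->]]].
rewrite dot_mulmx linear_sum /= mulmx_sumr summxE -c1; apply: ler_sum => i _.
rewrite linearZ /= -scalemxAr mxE -dot_mulmx.
by rewrite -[leRHS]mulr1 ler_wpM2l // xS.
Qed.

Lemma convex_hull_dual (x y : 'rV[R]_n) S : convex_hull S x ->
  (forall z, S z -> \sum_i z 0 i * y 0 i <= 1) -> \sum_i x 0 i * y 0 i <= 1.
Proof.
have dC (a b : 'rV[R]_n) : \sum_i a 0 i * b 0 i = \sum_i b 0 i * a 0 i.
  by apply: eq_bigr => i _; rewrite mulrC.
move=> Sx yS; rewrite dC.
have : dual_polytope (convex_hull S) y.
  by rewrite dual_convex_hull => z /yS; rewrite dC.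
exact.
Qed.

Definition simplex (v : 'M[R]_(n.+1, n)) : set 'rV[R]_n :=
  convex_hull [set row i v | i in setT].

Lemma simplex_mulmx (v : 'M[R]_(n.+1, n)) (c : 'rV[R]_n.+1) :
  (forall i, 0 <= c 0 i) -> \sum_i c 0 i = 1 -> simplex v (c *m v).
Proof.
move=> c0 c1; exists n.+1, (fun i => row i v), (fun i => c 0 i).
by split=> //; rewrite mulmx_sum_row.
Qed.

Local Notation N := (n.+1%:R : R).

(* The rows of [v] and of [x] are the vertices of two simplices containing the
   origin, the [i]-th row of [x] being the normal to the facet of the first
   opposite to its [i]-th vertex. *)
Definition polar_simplices (v x : 'M[R]_(n.+1, n)) : Prop :=
  [/\ (const_mx 1 : 'rV_n.+1) *m v = 0, (const_mx 1 : 'rV_n.+1) *m x = 0,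
      v *m x^T = const_mx 1 - N%:M & x^T *m v = - N%:M].

Lemma polar_simplices_sym (v x : 'M[R]_(n.+1, n)) :
  polar_simplices v x -> polar_simplices x v.
Proof.
case=> v0 x0 vx xv; split=> //.
  by rewrite -[LHS]trmxK trmx_mul trmxK vx linearB /= trmx_const tr_scalar_mx.
by rewrite -[LHS]trmxK trmx_mul trmxK xv linearN /= tr_scalar_mx.
Qed.

Variables v x : 'M[R]_(n.+1, n).
Hypothesis vx : polar_simplices v x.

Let N_neq0 : N != 0. Proof. by rewrite pnatr_eq0. Qed.

(** Coordinate [i] is the slack of [y] in the facet inequality with normal [row i x], divided by
    [N]; nonnegative coordinates thus mean that all the facet inequalities hold. *)
Definition barycentric (y : 'rV[R]_n) : 'rV[R]_n.+1 :=
  N^-1 *: (const_mx 1 - y *m x^T).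

Lemma barycentricK y : barycentric y *m v = y.
Proof.
case: vx => v0 _ _ xv.
rewrite -scalemxAl mulmxBl v0 -mulmxA xv mulmxN opprK add0r mul_mx_scalar.
by rewrite scalerA mulVf ?scale1r.
Qed.

Lemma sum_barycentric y : \sum_i barycentric y 0 i = 1.
Proof.
case: vx => _ x0 _ _.
have -> : \sum_i barycentric y 0 i = (barycentric y *m (const_mx 1 : 'rV_n.+1)^T) 0 0.
  by rewrite mxE; apply: eq_bigr => i _; rewrite !mxE mulr1.
rewrite -scalemxAl mulmxBl -mulmxA -trmx_mul x0 trmx0 mulmx0 subr0 !mxE.
under eq_bigr do rewrite !mxE mulr1.
by rewrite sumr_const card_ord mulVf.
Qed.

Lemma barycentricE y i :
  barycentric y 0 i = N^-1 * (1 - \sum_j y 0 j * x i j).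
Proof.
by rewrite !mxE; congr (_ * (_ - _)); apply: eq_bigr => j _; rewrite mxE.
Qed.

Lemma simplex_halfspaces y :
  (forall i, \sum_j y 0 j * x i j <= 1) -> simplex v y.
Proof.
move=> yx; rewrite -[y]barycentricK; apply: simplex_mulmx; last exact: sum_barycentric.
by move=> i; rewrite barycentricE mulr_ge0 ?invr_ge0 ?subr_ge0.
Qed.

Lemma full_dimensional_simplex : full_dimensional (simplex v).
Proof.
apply/seteqP; split=> // y _.
exists n.+1, (fun i => row i v), (fun i => barycentric y 0 i); split.
- by move=> i; apply: sub_convex_hull; exists i.
- exact: sum_barycentric.
- by rewrite -mulmx_sum_row barycentricK.
Qed.

Lemma interior_simplex0 : interior (simplex v) 0.
Proof.
(* [B] bounds the sum of absolute values of each normal, so points of sup norm at most [(1 + B)^-1]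
   satisfy every facet inequality; the added 1 keeps the radius defined when [B = 0]. *)
pose B := \sum_i \sum_j `|x i j|.
have B0 : 0 <= B by apply: sumr_ge0 => i _; apply: sumr_ge0.
apply/nbhs_ballP; exists (1 + B)^-1 => /=; first by rewrite invr_gt0; lra.
move=> y [_ yB]; apply: simplex_halfspaces => i.
apply: (@le_trans _ _ (\sum_j (1 + B)^-1 * `|x i j|)).
  apply: ler_sum => j _; apply: le_trans (ler_norm _) _; rewrite normrM ler_wpM2r //.
  have := yB 0 j; rewrite /ball /= mxE sub0r normrN; exact: ltW.
rewrite -mulr_sumr mulrC ler_pdivrMr ?mul1r; last by lra.
apply: (@le_trans _ _ B); last by lra.
rewrite /B [leRHS](bigD1 i) //= lerDl; apply: sumr_ge0 => k _; exact: sumr_ge0.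
Qed.

Lemma dot_polar i k :
  \sum_j x i j * v k j = if k == i then 1 - N else 1.
Proof.
case: vx => _ _ /matrixP/(_ k i) + _; rewrite !mxE => E.
transitivity (\sum_j v k j * x^T j i).
  by apply: eq_bigr => j _; rewrite mxE mulrC.
by rewrite E; case: eqP; rewrite ?subr0.
Qed.

End Polytopes.

(** * The dual of a simplex and its generators *)

Section Duality.

Local Open Scope classical_set_scope.

Variables (R : realType) (n : nat) (v x : 'M[R]_(n.+1, n)).
Hypothesis vx : polar_simplices v x.

(** The polar relation is symmetric, so the inequalities with normals in [v] cut out [simplex x];
    its vertices satisfy them since every product is 1 or [1 - N]. *)
Lemma dual_simplex : dual_polytope (simplex v) = simplex x.
Proof.
rewrite dual_convex_hull; apply/seteqP; split=> y /=.
  move=> yv; apply: (simplex_halfspaces (polar_simplices_sym vx)) => i.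
  by have := yv (row i v) (ex_intro2 _ _ i I erefl); under eq_bigr do rewrite mxE.
move=> xy _ [k _ <-]; apply: convex_hull_dual xy _ => _ [i _ <-].
under eq_bigr do rewrite !mxE.
rewrite (dot_polar vx); case: eqP => _ //.
by rewrite gerBl ler0n.
Qed.

(* A generator carrying positive weight in [row i x] lies on every facet
   through that vertex, hence equals it. *)
Lemma simplex_generators (S : set 'rV[R]_n) :
  convex_hull S = simplex x -> forall i, S (row i x).
Proof.
move=> Sx i.
have [m [p [c [Sp c0 c1 xp]]]] : convex_hull S (row i x).
  by rewrite Sx; apply: sub_convex_hull; exists i.
have pv l k : \sum_j p l 0 j * v k j <= 1.
  have : dual_polytope (simplex v) (p l).
    by rewrite dual_simplex -Sx; exact/sub_convex_hull/Sp.
  move=> /(_ (row k v)); under eq_bigr do rewrite mxE; apply.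
  by apply: sub_convex_hull; exists k.
have [l cl] : exists l, 0 < c l.
  apply/existsP; apply: contraT; rewrite negb_exists => /forallP cn.
  suff : \sum_i c i <= 0 by rewrite c1 ler10.
  by apply: sumr_le0 => l _; rewrite leNgt cn.
have pv1 k : k != i -> \sum_j p l 0 j * v k j = 1.
  move=> ki; apply/eqP; rewrite eq_le pv /= leNgt; apply/negP => lt1.
  (* Averaging keeps the inequality strict because [l] has positive weight, whereas [dot_polar]
     gives exactly 1. *)
  have : \sum_j row i x 0 j * v k j < 1.
    rewrite xp.
    under eq_bigr do rewrite summxE mulr_suml.
    rewrite exchange_big /= -c1 [ltLHS](bigD1 l) //= [ltRHS](bigD1 l) //=.
    apply: ltr_leD.
      under eq_bigr do rewrite mxE -mulrA.
      by rewrite -mulr_sumr -[ltRHS]mulr1 ltr_pM2l.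
    apply: ler_sum => q _.
    under eq_bigr do rewrite mxE -mulrA.
    by rewrite -mulr_sumr -[leRHS]mulr1 ler_wpM2l.
  under eq_bigr do rewrite mxE.
  by rewrite (dot_polar vx) (negPf ki) ltxx.
(* The rows of [v] sum to zero, so the products with the rows other than [i] determine the one with
   row [i]. *)
have vsum k (y : 'rV[R]_n) : \sum_j y 0 j * v k j =
    - \sum_(q | q != k) \sum_j y 0 j * v q j.
  apply/eqP; rewrite -addr_eq0; apply/eqP.
  transitivity (\sum_q \sum_j y 0 j * v q j); first by rewrite [RHS](bigD1 k).
  rewrite exchange_big big1 //= => j _; rewrite -mulr_sumr.
  case: vx => /matrixP/(_ 0 j) + _ _ _; rewrite !mxE.
  by under eq_bigr do rewrite mxE mul1r; move=> ->; rewrite mulr0.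
suff -> : row i x = p l by [].
have sv := polar_simplices_sym vx.
rewrite -[LHS](barycentricK sv) -[RHS](barycentricK sv); congr (_ *m _).
apply/rowP => k; rewrite !barycentricE; congr (_ * (1 - _)).
have xv1 q : q != i -> \sum_j row i x 0 j * v q j = 1.
  move=> qi; under eq_bigr do rewrite mxE.
  by rewrite (dot_polar vx) (negPf qi).
have [->|ki] := eqVneq k i; last by rewrite xv1 ?pv1.
by rewrite !vsum; congr (- _); apply: eq_bigr => q qi; rewrite xv1 ?pv1.
Qed.

End Duality.

(** * Facet normals from Cramer's rule *)

Section FacetNormals.

Variables (R : realType) (n : nat) (M : 'M[R]_(n.+1, n)).
Hypothesis M_sum : (const_mx 1 : 'rV_n.+1) *m M = 0.
Hypothesis M_unit : forall i, \det (row' i M) != 0.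

(* Cramer's rule for [row' i M *m x = 1]. *)
Definition facet_normals : 'M[R]_(n.+1, n) :=
  \matrix_(i, j) ((\sum_k cofactor (row' i M) k j) / \det (row' i M)).

Lemma mulmx_inj_simplex p (Z : 'M[R]_(n, p)) : M *m Z = 0 -> Z = 0.
Proof.
move=> MZ; have U : row' ord0 M \in unitmx by rewrite unitmxE unitfE.
rewrite -(mulKmx U Z); suff -> : row' ord0 M *m Z = 0 by rewrite mulmx0.
apply/matrixP => i j; have /matrixP/(_ (lift ord0 i) j) := MZ.
rewrite !mxE => E; rewrite -[RHS]E; apply: eq_bigr => k _; by rewrite !mxE.
Qed.

Lemma mulmx_facet_normals : M *m facet_normals^T = const_mx 1 - (n.+1%:R)%:M.
Proof.
have off i k : k != i -> (M *m facet_normals^T) k i = 1.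
  case: (unliftP i k) => [k' ->|->]; last by rewrite eqxx.
  move=> _; rewrite mxE.
  transitivity ((\sum_l (row' i M *m \adj (row' i M)) k' l) / \det (row' i M)).
    under eq_bigr do rewrite !mxE mulrA mulr_sumr.
    rewrite -mulr_suml exchange_big /=; congr (_ / _).
    by apply: eq_bigr => l _; rewrite mxE; apply: eq_bigr => j _; rewrite !mxE.
  rewrite mul_mx_adj (bigD1 k') //= big1 ?addr0 ?mxE ?eqxx ?mulr1n ?mulfV //.
  by move=> l lk; rewrite mxE eq_sym (negPf lk).
apply/matrixP => k i; rewrite [RHS]mxE [const_mx _ _ _]mxE [(- _%:M) k i]mxE [_%:M k i]mxE.
have [->|ki] := eqVneq k i; last by rewrite off // subr0.
rewrite mulr1n.
(* Each column of the product sums to zero, and its [n] entries off the diagonal are 1, which leaves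
   [- n] on the diagonal. *)
have /matrixP/(_ 0 i) : (const_mx 1 : 'rV_n.+1) *m (M *m facet_normals^T) = 0.
  by rewrite mulmxA M_sum mul0mx.
rewrite !mxE (bigD1 i) //= [X in _ + X](eq_bigr (fun=> 1)); last first.
  by move=> l li; rewrite off // mxE mulr1.
rewrite sumr_const cardC1 card_ord mxE mul1r /= -[in 1 - _]natr1.
by move/eqP; rewrite addr_eq0 mxE => /eqP ->; ring.
Qed.

(** Left multiplication by [M] is injective, so the two identities not yet known may be checked
    after multiplying by [M], where [mulmx_facet_normals] applies. *)
Lemma polar_facet_normals : polar_simplices M facet_normals.
Proof.
have JM : (const_mx 1 : 'M_n.+1) *m M = 0.
  apply/matrixP => i j; have /matrixP/(_ 0 j) := M_sum; rewrite !mxE => E.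
  by rewrite -[RHS]E; apply: eq_bigr => k _; rewrite !mxE.
split=> //; first last.
- apply/eqP; rewrite -subr_eq0 opprK; apply/eqP/mulmx_inj_simplex.
  rewrite mulmxDr mulmxA mulmx_facet_normals mulmxBl.
  rewrite JM sub0r.
  by rewrite mul_scalar_mx mul_mx_scalar addNr.
- exact: mulmx_facet_normals.
apply: trmx_inj; rewrite trmx_mul trmx0; apply: mulmx_inj_simplex.
rewrite mulmxA mulmx_facet_normals mulmxBl mul_scalar_mx.
apply/matrixP => i j; rewrite !mxE (eq_bigr (fun=> 1)) ?sumr_const ?card_ord ?mulr1 ?subrr //.
by move=> k _; rewrite !mxE mulr1.
Qed.

End FacetNormals.

Lemma lattice_simplex (R : realType) n (X : 'M[int]_(n.+1, n)) :
  lattice_polytope (simplex (map_mx (intr : int -> R) X)).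
Proof.
exists [seq row i X | i <- enum 'I_n.+1]; congr convex_hull.
apply/seteqP; split=> y /=.
  case=> i _ <-; exists (row i X); last by rewrite map_row.
  by apply/mapP; exists i; rewrite ?mem_enum.
by case=> _ /mapP[i _ ->] <-; exists i; rewrite ?map_row.
Qed.

(** * Integrality of the dual of the Laplacian simplex *)

Section LaplacianSimplex.

Local Open Scope classical_set_scope.

Variables (R : realType) (n : nat) (e : rel 'I_n.+1).
Hypotheses (e_sym : symmetric e) (e_irr : irreflexive e).
Hypothesis e_conn : connected_graph e.

Let M : 'M[R]_(n.+1, n) := map_mx (intr : int -> R) (LB e).

Lemma row'_LB i : row' i M = map_mx (intr : int -> R) (LB_del e i).
Proof. by apply/matrixP => k j; rewrite !mxE. Qed.

Lemma det_LB_del_neq0 i : \det (LB_del e i) != 0.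
Proof.
have := num_spanning_trees_gt0 i e_sym e_irr e_conn.
apply: contraTneq => d0; have := det_LB_del i e_sym e_irr.
by rewrite d0 mulr0; lia.
Qed.

Lemma polar_laplacian_simplex : polar_simplices M (facet_normals M).
Proof.
apply: polar_facet_normals => [|i].
  apply/matrixP => i j; rewrite !mxE.
  under eq_bigr do rewrite !mxE mul1r.
  by rewrite -[RHS](congr1 (intr : int -> R) (LB_col_sum j e_sym e_irr)) rmorph_sum;
    apply: eq_bigr => k _; rewrite !mxE.
by rewrite row'_LB det_map_mx intr_eq0 det_LB_del_neq0.
Qed.

(** By [det_LB_del] the two divisors differ only by a sign. *)
Lemma dvdz_num_spanning_trees i (a : int) :
  ((num_spanning_trees e)%:Z %| a)%Z = (\det (LB_del e i) %| a)%Z.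
Proof.
by rewrite (det_LB_del i e_sym e_irr) !dvdzE abszM abszX /= exp1n mul1n.
Qed.

Lemma facet_normals_LB i j : facet_normals M i j =
  (\sum_k cofactor (LB_del e i) k j)%:~R / (\det (LB_del e i))%:~R.
Proof.
rewrite mxE row'_LB det_map_mx; congr (_ / _).
by rewrite rmorph_sum; apply: eq_bigr => k _; rewrite cofactor_map_mx.
Qed.

(** Any set generating the dual contains all its vertices, so integral generators force integral
    normals. *)
Lemma lattice_dual_laplacian_simplex :
  lattice_polytope (dual_polytope (laplacian_simplex R e)) <->
  exists X : 'M[int]_(n.+1, n), facet_normals M = map_mx (intr : int -> R) X.
Proof.
rewrite (dual_simplex polar_laplacian_simplex); split.
  case=> s sE.
  have vs i := simplex_generators polar_laplacian_simplex (esym sE) i.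
  have /all_sig2[X _ XE] : forall i,
      {w | w \in s & map_mx (intr : int -> R) w = row i (facet_normals M)}.
    by move=> i; apply/cid2; have [w ws <-] := vs i; exists w.
  exists (\matrix_i X i); apply/row_matrixP => i.
  by rewrite -XE -map_row rowK.
case=> X ->; exact: lattice_simplex.
Qed.

Lemma integral_facet_normals :
  (exists X : 'M[int]_(n.+1, n), facet_normals M = map_mx (intr : int -> R) X) <->
  forall i j, ((num_spanning_trees e)%:Z %| \sum_k cofactor (LB_del e i) k j)%Z.
Proof.
have d0 i : (\det (LB_del e i))%:~R != 0 :> R by rewrite intr_eq0 det_LB_del_neq0.
split=> [[X XE] i j|dvd].
  rewrite (dvdz_num_spanning_trees i); apply/dvdzP; exists (X i j).
  have /matrixP/(_ i j) := XE; rewrite facet_normals_LB mxE => E.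
  by apply: (@intr_inj R); rewrite rmorphM /= -E divfK.
exists (\matrix_(i, j) ((\sum_k cofactor (LB_del e i) k j) %/ \det (LB_del e i))%Z).
apply/matrixP => i j; rewrite facet_normals_LB !mxE.
have := dvd i j; rewrite (dvdz_num_spanning_trees i) => /divzK E.
by rewrite -{1}E rmorphM /= mulfK.
Qed.

End LaplacianSimplex.

Theorem theorem3p7 (R : realType) (n : nat) (e : rel 'I_n.+1)
    (e_sym : symmetric e) (e_irr : irreflexive e)
    (e_conn : connected_graph e) :
  (reflexive_polytope (laplacian_simplex R e) <->
   forall (i : 'I_n.+1) (j : 'I_n),
     ((num_spanning_trees e)%:Z %| \sum_(k < n) cofactor (LB_del e i) k j)%Z)
  /\
  (forall (i : 'I_n.+1) (j : 'I_n),
     \sum_(k < n) cofactor (LB_del e i) k j =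
     \sum_(k < n) (-1) ^+ (k + j) * minor (LB_del e i) k j).
Proof.
(* The cofactor formula holds by unfolding [cofactor] and [minor]. *)
split=> //.
have polar := polar_laplacian_simplex R e_sym e_irr e_conn.
have [dual_int int_dual] := lattice_dual_laplacian_simplex R e_sym e_irr e_conn.
have [int_dvd dvd_int] := integral_facet_normals R e_sym e_irr e_conn.
split=> [[_ _ _ /dual_int/int_dvd]|/dvd_int/int_dual ?] //.
split=> //.
- exact: lattice_simplex.
- exact: full_dimensional_simplex polar.
- exact: interior_simplex0 polar.
Qed.
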